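(* For $j\in\{1,\dots,L\}$ let $a_j\in\mathbb{R}^d$ with $\|a_j\|=1$, $b_j\in\mathbb{R}$, and $H_j=\{x\in\mathbb{R}^d: a_j^\top x\le b_j\}$; let $0\le V\le0.5$. Let $\mathsf{C}$ be the inverse cumulative distribution function of the standard normal distribution. For all $(i,j,t)\in\{0,\dots,\mathsf{K}-1\}\times\{1,\dots,L\}\times\{1,\dots,N\}$ and for any symmetric positive definite $\Sigma_r\in\mathbb{R}^{d\times d}$, the chance constraint $$\mathbb{P}\Big(\bigwedge_{j=1}^{L}\bigwedge_{t=1}^{N}x_t\in H_j\Big)\ge1-V$$ admits the following convex reformulation: $$a_j^\top\mu_t^i+\mathsf{C}(1-r_{ijt})\left(\frac{a_j^\top\Sigma_t^ia_j}{2\sqrt{a_j^\top\Sigma_ra_j}}+\frac12\sqrt{a_j^\top\Sigma_ra_j}\right)\le b_j,$$ $$\sum_{i=0}^{\mathsf{K}-1}\sum_{j=1}^{L}\sum_{t=1}^{N}\alpha_ir_{ijt}\le V,$$ where $r_{ijt}\in[0,1)$ is a risk parameter.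
   Context: The state of the linear system $x_{t+1}=Ax_t+Bu_t$, $x_t\in\mathbb{R}^d$, $u_t\in\mathbb{R}^m$, has initial distribution $x_0\sim\mathrm{GMM}(\{\alpha_i,\mu_0^i,\Sigma_0^i\}_{i=0}^{\mathsf{K}-1})$, where $\mathrm{GMM}(\{\alpha_i,\mu^i,\Sigma^i\}_{i=0}^{\mathsf{K}-1})$ denotes the Gaussian mixture $\sum_i\alpha_i\,\mathcal{N}(\mu^i,\Sigma^i)$ with $\alpha_i\ge0$, $\sum_i\alpha_i=1$. The control is the randomized affine policy $u_t=v_t^i+K_t^i(x_t-\mu_t^i)$ chosen with probability proportional (over $i$) to $\alpha_i$ times the $\mathcal{N}(\mu_t^i,\Sigma_t^i)$ density at $x_t$, with $v_t^i\in\mathbb{R}^m$, $K_t^i\in\mathbb{R}^{m\times d}$. Under it $x_t\sim\mathrm{GMM}(\{\alpha_i,\mu_t^i,\Sigma_t^i\}_{i=0}^{\mathsf{K}-1})$, where $\mu^i_{t+1}=A\mu^i_t+Bv^i_t$ and $\Sigma^i_{t+1}=(A+BK^i_t)\Sigma^i_t(A+BK^i_t)^\top$. The $r_{ijt}$ form a fixed risk allocation; $N$ is the time horizon and $V$ the allowed probability of violation.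
   Formalization: That the constraints imply the chance constraint is proved only if r_ijt ≤ 1/2 whenever α_i > 0 (so C(1−r_ijt) ≥ 0); for r_ijt in [0,1) alone it is false for mixtures, e.g. α=(1/4,3/4), r=(0.9,0.1), V=0.3. *)

(* Defs.v *)
(* MathComp-Analysis *)
From HB Require Import structures.
From mathcomp Require Import all_boot all_order all_algebra.
From mathcomp Require Import all_classical all_reals all_analysis.
Set Implicit Arguments.
Unset Strict Implicit.
Unset Printing Implicit Defensive.
Import Order.TTheory GRing.Theory Num.Theory.
Import numFieldNormedType.Exports.
Local Open Scope classical_set_scope.
Local Open Scope ring_scope.

Definition dot (R : realType) (d : nat) (a y : 'cV[R]_d) : R :=
  (a^T *m y) 0 0.

Definition quad (R : realType) (d : nat) (S : 'M[R]_d) (a : 'cV[R]_d) : R :=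
  (a^T *m S *m a) 0 0.

(* The library norm `|a| of a matrix is the maximum norm. *)
Definition norm2 (R : realType) (d : nat) (a : 'cV[R]_d) : R :=
  Num.sqrt (dot a a).

Definition posdef (R : realType) (d : nat) (S : 'M[R]_d) : Prop :=
  S^T = S /\ forall a : 'cV[R]_d, a != 0 -> 0 < quad S a.

Definition halfspace (R : realType) (d : nat) (a : 'cV[R]_d) (b : R) :
  set 'cV[R]_d := [set y | dot a y <= b].

Definition borel_cV (R : realType) (d : nat) :=
  g_sigma_algebraType (@open 'cV[R]_d).

(* Indexed by the variance [s2].  The case [s2 = 0] is separate because
   [normal_prob m 0] is the uniform law on [0, 1], not the Dirac mass at [m]. *)
Definition normal_law (R : realType) (m s2 : R) (E : set R) : \bar R :=
  if s2 == 0 then \d_m E else normal_prob m (Num.sqrt s2) E.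

(* N(mu, S), possibly degenerate: every linear form c^T y has the law
   N(c^T mu, c^T S c) on the line. *)
Definition is_gaussian (R : realType) (d : nat)
    (nu : probability (borel_cV R d) R) (mu : 'cV[R]_d) (S : 'M[R]_d) : Prop :=
  forall (c : 'cV[R]_d) (E : set R), measurable E ->
    nu [set y : 'cV[R]_d | E (dot c y)] = normal_law (dot c mu) (quad S c) E.

Definition is_GMM (R : realType) (d K : nat)
    (lambda : probability (borel_cV R d) R) (alpha : 'I_K -> R)
    (mu : 'I_K -> 'cV[R]_d) (S : 'I_K -> 'M[R]_d) : Prop :=
  exists nu : 'I_K -> probability (borel_cV R d) R,
    (forall i, is_gaussian (nu i) (mu i) (S i)) /\
    (forall E : set (borel_cV R d), measurable E ->
       lambda E = (\sum_(i < K) (alpha i)%:E * nu i E)%E).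

Definition gauss_pdf (R : realType) (d : nat) (mu : 'cV[R]_d) (S : 'M[R]_d)
    (y : 'cV[R]_d) : R :=
  expR (- (quad (invmx S) (y - mu) / 2)) / Num.sqrt ((2 * pi) ^+ d * \det S).

Definition mode_weight (R : realType) (d K : nat) (alpha : 'I_K -> R)
    (mu : 'I_K -> 'cV[R]_d) (S : 'I_K -> 'M[R]_d) (i : 'I_K)
    (y : 'cV[R]_d) : R :=
  alpha i * gauss_pdf (mu i) (S i) y /
  \sum_(k < K) alpha k * gauss_pdf (mu k) (S k) y.

(* [x] is the state, [u] the control and [mode t] the index drawn at time [t].
   [cl_mode_law] says that, conditionally on the state at time [t], mode [i] has
   probability [mode_weight]; the densities exist because of [cl_posdef].
   [cl_GMM] at time 0 is the initial law; at later times it records the law of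
   the state under the policy. *)
Record closed_loop (R : realType) (dsp : measure_display)
    (T : measurableType dsp) (P : probability T R) (d m K N : nat)
    (A : 'M[R]_d) (B : 'M[R]_(d, m)) (alpha : 'I_K -> R)
    (mu : nat -> 'I_K -> 'cV[R]_d) (Sigma : nat -> 'I_K -> 'M[R]_d)
    (v : nat -> 'I_K -> 'cV[R]_m) (G : nat -> 'I_K -> 'M[R]_(m, d))
    (x : nat -> {RV P >-> borel_cV R d}) (u : nat -> T -> 'cV[R]_m)
    (mode : nat -> T -> 'I_K) : Prop := {
  cl_alpha_ge0 : forall i, 0 <= alpha i;
  cl_alpha_sum : \sum_(i < K) alpha i = 1;
  cl_posdef : forall t i, (t < N)%N -> posdef (Sigma t i);
  cl_mean : forall t i, (t < N)%N -> mu t.+1 i = A *m mu t i + B *m v t i;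
  cl_cov : forall t i, (t < N)%N ->
    Sigma t.+1 i = (A + B *m G t i) *m Sigma t i *m (A + B *m G t i)^T;
  cl_state : forall t w, (t < N)%N ->
    x t.+1 w = A *m (x t w : 'cV[R]_d) + B *m u t w;
  cl_control : forall t w, (t < N)%N ->
    u t w = v t (mode t w) +
            G t (mode t w) *m ((x t w : 'cV[R]_d) - mu t (mode t w));
  cl_mode_measurable : forall t i, (t < N)%N ->
    measurable [set w | mode t w = i];
  cl_mode_law : forall t i (E : set (borel_cV R d)), (t < N)%N ->
    measurable E ->
    P (x t @^-1` E `&` [set w | mode t w = i]) =
    (\int[P]_(w in x t @^-1` E)
       (mode_weight alpha (mu t) (Sigma t) i (x t w))%:E)%E;
  cl_GMM : forall t, (t <= N)%N ->
    is_GMM (distribution P (x t)) alpha (mu t) (Sigma t)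
}.

Definition std_normal_cdf (R : realType) (z : R) : \bar R :=
  normal_prob 0 1 `]-oo, z].

(* Inverse of [std_normal_cdf] on the open unit interval; the value at 1 is
   +oo, which is needed because the risk parameters may vanish. *)
Definition std_normal_quantile (R : realType) (p : R) : \bar R :=
  ereal_inf [set z%:E | z in [set z : R | (p%:E <= std_normal_cdf z)%E]].

Definition affine_std (R : realType) (d : nat) (a : 'cV[R]_d)
    (Sr S : 'M[R]_d) : R :=
  quad S a / (2 * Num.sqrt (quad Sr a)) + 2^-1 * Num.sqrt (quad Sr a).

(* Constraints on the decision variables [p = (mean, covariance)], for a fixed
   risk allocation [r] and fixed reference covariances [Sr]. *)
Definition reformulation (R : realType) (d K L N : nat) (alpha : 'I_K -> R)
    (a : 'I_L -> 'cV[R]_d) (b : 'I_L -> R) (V : R)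
    (Sr : 'I_K -> 'I_L -> nat -> 'M[R]_d) (r : 'I_K -> 'I_L -> nat -> R)
    (p : (nat -> 'I_K -> 'cV[R]_d) * (nat -> 'I_K -> 'M[R]_d)) : Prop :=
  (forall i j t, (1 <= t <= N)%N ->
     ((dot (a j) (p.1 t i))%:E +
      std_normal_quantile (1 - r i j t) *
        (affine_std (a j) (Sr i j t) (p.2 t i))%:E <= (b j)%:E)%E) /\
  \sum_(i < K) \sum_(j < L) \sum_(1 <= t < N.+1) alpha i * r i j t <= V.

(* Main.v *)
(* Union bound over the half-spaces and the times, conditionally on the mixture
   component: it is enough that each Gaussian a_j^T x_t with law
   N(a_j^T mu, s2) exceeds b_j with probability at most r.  As r <= 1/2 the
   quantile at 1 - r is nonnegative, and by AM-GM
     sqrt s2 <= s2 / (2 s) + s / 2,   s = sqrt (a_j^T Sr a_j),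
   so the constraint implies a_j^T mu + quantile (1 - r) * sqrt s2 <= b_j.
   For r = 0 the quantile is +oo, which the constraint excludes because the
   factor of the quantile is positive.  For a finite quantile the constraint is
   affine in the mean and the covariance, hence convex. *)
Require Import Defs.
From HB Require Import structures.
From mathcomp Require Import all_boot all_order all_algebra.
From mathcomp Require Import all_classical all_reals all_analysis.
From mathcomp Require Import measurable_realfun ring lra.
Set Implicit Arguments.
Unset Strict Implicit.
Unset Printing Implicit Defensive.
Import Order.TTheory GRing.Theory Num.Theory.
Import numFieldNormedType.Exports.
Local Open Scope classical_set_scope.
Local Open Scope ring_scope.

(** * The standard normal distribution function and its quantile *)

(** Change of variables along the increasing affine map [F], whose constant derivative [s^-1] turns
    the standard density into that of parameters [m], [s]. *)
Lemma normal_prob_standardize (R : realType) (m s z : R) : 0 < s ->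
  normal_prob m s `]-oo, z] = std_normal_cdf ((z - m) / s).
Proof.
move=> s0; rewrite /std_normal_cdf /normal_prob.
pose F x := (x - m) / s.
have dF (y : R) : is_derive y 1 F s^-1.
  rewrite /F; apply: is_derive_eq.
  by rewrite /GRing.scale/= mulr0 add0r oppr0 addr0 mulr1.
have F'E : F^`()%classic = cst s^-1.
  by apply/funext => y; rewrite derive1E derive_val.
have cF : continuous F.
  by move=> y; apply/differentiable_continuous/derivable1_diffP.
rewrite (@increasing_ge0_integration_by_substitutionNy _ F)//.
- apply: eq_integral => y _; congr EFin.
  rewrite F'E /= !normal_pdfE ?oner_eq0 ?gt_eqF//.
  rewrite /normal_peak /normal_fun /F !fctE/= [RHS]mulrAC; congr (_ * expR _).
    rewrite -mulrnAr sqrtrM ?sqr_ge0// sqrtr_sqr gtr0_norm// expr1n mul1r.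
    by rewrite invfM mulrC.
  by field; rewrite gt_eqF.
- by move=> y w _ _ yw; rewrite /F ltr_pM2r ?invr_gt0// ltrD2r.
- by rewrite F'E => ? _; exact: cst_continuous.
- by rewrite F'E; exact: is_cvg_cst.
- by rewrite F'E; exact: cvg_cst.
- by split=> //; apply: cvg_at_left_filter; exact: cF.
- apply/gt0_cvgMlNy; last exact: cvg_addrr_Ny.
  by rewrite invr_gt0.
- by apply/continuous_subspaceT/continuous_normal_pdf; rewrite oner_eq0.
- by move=> y _; exact: normal_pdf_ge0.
Qed.

Lemma normal_prob_upper_tail (R : realType) (z : R) :
  normal_prob 0 1 `[z, +oo[ = std_normal_cdf (- z).
Proof.
rewrite /std_normal_cdf /normal_prob ge0_integration_by_substitutionNy.
- apply: eq_integral => y _; congr EFin.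
  by rewrite /= !normal_pdfE ?oner_eq0// /normal_fun !subr0 sqrrN.
- by apply/continuous_subspaceT/continuous_normal_pdf; rewrite oner_eq0.
- by move=> y _; exact: normal_pdf_ge0.
Qed.

(** On this interval the density is at least its value at the endpoint [z], which is positive; the
    integral is at least that value times the length. *)
Lemma normal_prob_sym_itv_gt0 (R : realType) (z : R) : 0 < z ->
  (0 < normal_prob 0 1 `](- z)%R, z[)%E.
Proof.
move=> z0; have p0 : 0 < normal_pdf 0 1 z.
  by rewrite normal_pdfE ?oner_eq0// mulr_gt0 ?normal_peak_gt0 ?expR_gt0.
apply: (@lt_le_trans _ _
    (\int[lebesgue_measure]_(x in `](- z)%R, z[) (normal_pdf (0 : R) 1 z)%:E)%E).
  rewrite integral_cst//= lebesgue_measure_itv/= lte_fin gtrN// -EFinD -EFinM.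
  by rewrite lte_fin mulr_gt0// opprK addr_gt0.
apply: ge0_le_integral => //=.
- by move=> y _; rewrite lee_fin ltW.
- by apply/measurable_EFinP/measurable_funTS; exact: measurable_normal_pdf.
- move=> y; rewrite in_itv/= => yz.
  rewrite lee_fin !normal_pdfE ?oner_eq0// ler_pM2l ?normal_peak_gt0 ?oner_eq0//.
  rewrite /normal_fun ler_expR !subr0 expr1n; nra.
Qed.

(** The line splits at [z] and [- z] into two tails of equal mass, by symmetry, and a middle
    interval of positive mass. *)
Lemma std_normal_cdf_lt_half (R : realType) (z : R) : z < 0 ->
  (std_normal_cdf z < 2^-1%:E)%E.
Proof.
move=> z0; pose N : probability _ R := normal_prob (0 : R) 1.
pose A : set R := `]-oo, z]%classic; pose B : set R := `]z, - z[%classic.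
pose C : set R := `[- z, +oo[%classic.
have NC : N C = N A by rewrite /N /C/= normal_prob_upper_tail opprK.
have mA : measurable A by exact: measurable_itv.
have mB : measurable B by exact: measurable_itv.
have mC : measurable C by exact: measurable_itv.
have AB0 : A `&` B = set0.
  by apply/seteqP; split=> // y []/=; rewrite /A /B/= !in_itv/=; lra.
have ABC0 : (A `|` B) `&` C = set0.
  by apply/seteqP; split=> // y []/=; rewrite /A /B /C/= !in_itv/=; lra.
have : (N A + N B + N C = 1)%E.
  rewrite -(probability_setT N) -measureU// -measureU//; last exact: measurableU.
  congr (N _); apply/seteqP; split=> // y _; rewrite /A /B /C/= !in_itv/= andbT.
  have [yz|zy] := leP y z; first by left; left.
  by have [|] := ltP y (- z); [left; right|right].
have : (0 < N B)%E.
  by have := @normal_prob_sym_itv_gt0 _ (- z); rewrite opprK oppr_gt0; exact.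
rewrite NC [std_normal_cdf z](_ : _ = N A)//.
rewrite -(@fineK _ (N A)) ?fin_num_measure//.
rewrite -(@fineK _ (N B)) ?fin_num_measure//.
rewrite -!EFinD !lte_fin => ? []; lra.
Qed.

Lemma le_std_normal_cdf (R : realType) (y z : R) : y <= z ->
  (std_normal_cdf y <= std_normal_cdf z)%E.
Proof.
by move=> yz; rewrite /std_normal_cdf le_measure ?inE//; exact: subset_itvl.
Qed.

Lemma std_normal_quantile_ge0 (R : realType) (p : R) : 2^-1 <= p ->
  (0 <= std_normal_quantile p)%E.
Proof.
move=> p_ge; apply: le_ereal_inf_tmp => _ [z /= pz <-].
rewrite lee_fin leNgt; apply/negP => /std_normal_cdf_lt_half.
by apply/negP; rewrite -leNgt (le_trans _ pz).
Qed.

(** The infimum defining the quantile need not be attained a priori: the inequality holds at every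
    [y > z] and passes to [z] by right continuity. *)
Lemma std_normal_cdf_ge_quantile (R : realType) (p z : R) :
  (std_normal_quantile p <= z%:E)%E -> (p%:E <= std_normal_cdf z)%E.
Proof.
(* The identity, as a random variable on the normal law, has [std_normal_cdf] as its distribution
   function. *)
move=> qz; pose X : {RV (normal_prob (0 : R) 1) >-> R} :=
  HB.pack (idfun : measurableTypeR R -> R)
    (isMeasurableFun.Build _ _ _ _ (idfun : measurableTypeR R -> R)
      (@measurable_id _ (measurableTypeR R) setT)).
have right_cvg : std_normal_cdf y @[y --> z^'+] --> std_normal_cdf z.
  exact: (@cdf_right_continuous _ _ _ _ X).
apply: (cvge_ge _ right_cvg).
near=> y.
have /ereal_inf_lt[_ [w /= pw <-]] : (std_normal_quantile p < y%:E)%E.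
  by rewrite (le_lt_trans qz)// lte_fin; near: y; exact: nbhs_right_gt.
by rewrite lte_fin => /ltW/le_std_normal_cdf; exact: le_trans.
Unshelve. all: by end_near. Qed.

(** * The tail of one Gaussian under the affine constraint *)

Lemma amgm_half (R : realType) (x s : R) : 0 < s ->
  x <= x ^+ 2 / (2 * s) + 2^-1 * s.
Proof.
move=> s0; rewrite -subr_ge0.
have -> : x ^+ 2 / (2 * s) + 2^-1 * s - x = (x - s) ^+ 2 / (2 * s).
  by field; rewrite gt_eqF.
by rewrite divr_ge0 ?sqr_ge0// mulr_ge0// ltW.
Qed.

Lemma normal_law_tail_le (R : realType) (m s2 s b p : R) :
  0 <= s2 -> 0 < s -> 2^-1 <= p <= 1 ->
  (m%:E + std_normal_quantile p * (s2 / (2 * s) + 2^-1 * s)%:E <= b%:E)%E ->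
  (normal_law m s2 `]b, +oo[ <= (1 - p)%:E)%E.
Proof.
move=> s2_ge0 s_gt0 /andP[p_ge p_le1].
have := std_normal_quantile_ge0 p_ge.
have c_gt0 : 0 < s2 / (2 * s) + 2^-1 * s.
  by rewrite ltr_wpDl// ?mulr_gt0// divr_ge0// mulr_ge0// ltW.
case qE : (std_normal_quantile p) => [q| |]//; last first.
  by move=> _; rewrite gt0_mulye ?lte_fin// addey.
rewrite lee_fin -EFinM -EFinD lee_fin => q_ge0 hb.
rewrite /normal_law; have [s20|s20] := eqVneq s2 0.
  (* Degenerate case: the law is the Dirac mass at [m], and [m <= b] because the quantile term is
     nonnegative, so the tail is null. *)
  rewrite diracE memNset ?lee_fin ?subr_ge0//=.
  rewrite in_itv/= andbT; apply/negP; rewrite -leNgt.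
  by rewrite (le_trans _ hb)// lerDl mulr_ge0// ltW.
have sd_gt0 : 0 < Num.sqrt s2 by rewrite sqrtr_gt0 lt_neqAle eq_sym s20.
have tailE : `]b, +oo[%classic = ~` (`]-oo, b]%classic : set R).
  by rewrite setCitvl.
rewrite tailE probability_setC// [X in (_ - X)%E](normal_prob_standardize _ _ sd_gt0).
suff : (p%:E <= std_normal_cdf ((b - m) / Num.sqrt s2))%E.
  by rewrite EFinB => ?; exact: leeB.
apply: std_normal_cdf_ge_quantile; rewrite qE lee_fin ler_pdivlMr//.
have := amgm_half (Num.sqrt s2) s_gt0; rewrite sqr_sqrtr// => amgm.
by rewrite lerBrDl (le_trans _ hb)// lerD2l ler_wpM2l.
Qed.

(** * Linear and quadratic forms *)

Lemma quad_linear (R : realType) (d : nat) (a : 'cV[R]_d) (k l : R)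
    (S1 S2 : 'M[R]_d) :
  quad (k *: S1 + l *: S2) a = k * quad S1 a + l * quad S2 a.
Proof.
by rewrite /quad mulmxDr mulmxDl -!scalemxAr -!scalemxAl !mxE.
Qed.

Lemma dot_linear (R : realType) (d : nat) (a : 'cV[R]_d) (k l : R)
    (y z : 'cV[R]_d) :
  dot a (k *: y + l *: z) = k * dot a y + l * dot a z.
Proof. by rewrite /dot mulmxDr -!scalemxAr !mxE. Qed.

(** Carries nonnegativity of variances through the covariance recursion. *)
Lemma quad_congr (R : realType) (d : nat) (M S : 'M[R]_d) (a : 'cV[R]_d) :
  quad (M *m S *m M^T) a = quad S (M^T *m a).
Proof. by rewrite /quad trmx_mul trmxK !mulmxA. Qed.

Lemma posdef_quad_ge0 (R : realType) (d : nat) (S : 'M[R]_d) (a : 'cV[R]_d) :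
  posdef S -> 0 <= quad S a.
Proof.
move=> [_ S_gt0]; have [->|/S_gt0/ltW//] := eqVneq a 0.
by rewrite /quad mulmx0 mxE.
Qed.

Lemma continuous_dot (R : realType) (d : nat) (a : 'cV[R]_d) :
  continuous (dot a).
Proof.
rewrite (_ : dot a = fun y => \sum_(i < d) a i 0 * y i 0); last first.
  by apply/funext => y; rewrite /dot mxE; apply: eq_bigr => i _; rewrite mxE.
elim: index_enum => [|i l IH] y.
  under eq_fun do rewrite big_nil.
  exact: cst_continuous.
under eq_fun do rewrite big_cons.
apply: (@continuousD R R^o _ (fun y : 'cV[R]_d => a i 0 * y i 0) _ y _ (IH y)).
exact: (@continuousM R 'cV[R]_d (cst (a i 0)) (fun y => y i 0) y
  (@cst_continuous _ _ _ _) (@coord_continuous _ _ _ _ _ _)).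
Qed.

(** * Convexity of the reformulation *)

(** For finite [q] the left-hand side is affine in the pair of [c] and [s]. For [q = +oo] the
    admissible pairs are those with [s < 0], or [s = 0] and [c <= b], a condition stable under
    positive weights; [q = -oo] reduces to this by changing the sign of [s]. *)
Lemma convex_le_mule (R : realType) (q : \bar R) (c1 c2 s1 s2 b k l : R) :
  0 < k -> 0 < l -> k + l = 1 ->
  (c1%:E + q * s1%:E <= b%:E)%E -> (c2%:E + q * s2%:E <= b%:E)%E ->
  ((k * c1 + l * c2)%:E + q * (k * s1 + l * s2)%:E <= b%:E)%E.
Proof.
move=> k0 l0 kl1.
(* For q = +oo the left-hand side is +oo, c or -oo according to the sign of s. *)
have le_pinfty (c s : R) :
    (c%:E + +oo * s%:E <= b%:E)%E <-> s < 0 \/ s = 0 /\ c <= b.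
  have [s0|s0|->] := ltgtP s 0.
  - by rewrite lt0_mulye ?lte_fin//= leNye; split=> // _; left.
  - rewrite gt0_mulye ?lte_fin// addey// leye_eq/=; split=> // h; exfalso.
    by case: h => [|[]]; lra.
  - by rewrite mule0 adde0 lee_fin; split=> [|[|[]//]]; [right|lra].
have mulNye (s : R) : (-oo * s%:E = +oo * (- s)%:E)%E.
  by rewrite EFinN muleN -mulNe.
have convex_pinfty (t1 t2 : R) :
    (c1%:E + +oo * t1%:E <= b%:E)%E -> (c2%:E + +oo * t2%:E <= b%:E)%E ->
    ((k * c1 + l * c2)%:E + +oo * (k * t1 + l * t2)%:E <= b%:E)%E.
  rewrite !le_pinfty => -[t1_lt0|[-> h1]] [t2_lt0|[-> h2]].
  - by left; nra.
  - by left; nra.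
  - by left; nra.
  - by right; split; nra.
case: q => [q| |].
- by rewrite -!EFinM -!EFinD !lee_fin; nra.
- exact: convex_pinfty.
- by rewrite !mulNye opprD -!mulrN; exact: convex_pinfty.
Qed.

(** The summand of [affine_std] free of the covariance makes it affine rather than linear, hence the
    condition [k + l = 1]. *)
Lemma affine_stdD (R : realType) (d : nat) (a : 'cV[R]_d) (k l : R)
    (Sr S1 S2 : 'M[R]_d) : k + l = 1 ->
  affine_std a Sr (k *: S1 + l *: S2) =
  k * affine_std a Sr S1 + l * affine_std a Sr S2.
Proof.
move=> kl1; have -> : l = 1 - k by rewrite -kl1 addrC addKr.
by rewrite /affine_std quad_linear; ring.
Qed.

Lemma convex_reformulation (R : realType) (d K L N : nat) (alpha : 'I_K -> R)
    (a : 'I_L -> 'cV[R]_d) (b : 'I_L -> R) (V : R)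
    (Sr : 'I_K -> 'I_L -> nat -> 'M[R]_d) (r : 'I_K -> 'I_L -> nat -> R) :
  convex_set (M := ((nat -> 'I_K -> 'cV[R]_d) * (nat -> 'I_K -> 'M[R]_d))%type)
    [set p | reformulation N alpha a b V Sr r p].
Proof.
(* Only weights strictly between 0 and 1 remain to be treated. The risk budget does not involve [p],
   so it carries over from [p1]. *)
apply/convex_setW => p1 p2; rewrite !inE => -[h1 hV] [h2 _] k k0 k1; rewrite inE.
split=> // i j t tN.
have l0 : 0 < 1 - k%:num by rewrite subr_gt0.
have := convex_le_mule k0 l0 (subrKC _ _) (h1 i j t tN) (h2 i j t tN).
by rewrite -dot_linear -affine_stdD ?subrKC.
Qed.

(** * Union bound and mixtures *)

Lemma measure_bigsetU_le (R : realType) (dsp : measure_display)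
    (T : measurableType dsp) (mu : {measure set T -> \bar R})
    (I : Type) (s : seq I) (A : I -> set T) :
  (forall i, measurable (A i)) ->
  (mu (\big[setU/set0]_(i <- s) A i) <= \sum_(i <- s) mu (A i))%E.
Proof.
move=> mA; elim: s => [|i s IH]; first by rewrite !big_nil measure0.
rewrite !big_cons; apply: le_trans (leeD2l _ IH).
by apply: measureU2 => //; exact: bigsetU_measurable.
Qed.

Lemma measurable_dot_gt (R : realType) (d : nat) (a : 'cV[R]_d) (b : R) :
  measurable ([set y | b < dot a y] : set (borel_cV R d)).
Proof.
apply: sub_sigma_algebra => /=.
apply: (@open_comp _ _ (dot a) [set z | b < z]); last exact: open_gt.
by move=> y _; exact: continuous_dot.
Qed.

(** The mixture law is the weighted sum of its components, so the tail bounds add up with the same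
    weights. A component of weight zero contributes nothing, so a bound is asked only where
    [alpha i] is positive. *)
Lemma GMM_tail_le (R : realType) (d K : nat)
    (lambda : probability (borel_cV R d) R) (alpha : 'I_K -> R)
    (mu : 'I_K -> 'cV[R]_d) (S : 'I_K -> 'M[R]_d) (a : 'cV[R]_d) (b : R)
    (rho : 'I_K -> R) :
  is_GMM lambda alpha mu S -> (forall i, 0 <= alpha i) ->
  (forall i, 0 < alpha i ->
     (normal_law (dot a (mu i)) (quad (S i) a) `]b, +oo[ <= (rho i)%:E)%E) ->
  (lambda [set y | (b < dot a y)%R] <= (\sum_(i < K) alpha i * rho i)%:E)%E.
Proof.
move=> [nu [nu_gauss lambdaE]] alpha_ge0 tail_le.
rewrite lambdaE; last exact: measurable_dot_gt.
rewrite -sumEFin; apply: lee_sum => i _; rewrite EFinM.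
have [->|alpha_neq0] := eqVneq (alpha i) 0; first by rewrite !mul0e.
have alpha_gt0 : 0 < alpha i by rewrite lt_neqAle eq_sym alpha_neq0 alpha_ge0.
apply: lee_wpmul2l; first by rewrite lee_fin.
apply: le_trans (tail_le i alpha_gt0); rewrite -nu_gauss; last first.
  exact: measurable_itv.
rewrite le_eqVlt; apply/orP; left; apply/eqP; congr (nu i _).
by apply/seteqP; split=> y /=; rewrite in_itv/= andbT.
Qed.

Lemma norm2_eq1_neq0 (R : realType) (d : nat) (a : 'cV[R]_d) :
  norm2 a = 1 -> a != 0.
Proof.
apply: contra_eqT => /negbNE/eqP->.
by rewrite /norm2 /dot mulmx0 mxE sqrtr0 eq_sym oner_eq0.
Qed.

Theorem proposition3 (R : realType) (dsp : measure_display)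
    (T : measurableType dsp) (P : probability T R) (d m K L N : nat)
    (A : 'M[R]_d) (B : 'M[R]_(d, m)) (alpha : 'I_K -> R)
    (mu : nat -> 'I_K -> 'cV[R]_d) (Sigma : nat -> 'I_K -> 'M[R]_d)
    (v : nat -> 'I_K -> 'cV[R]_m) (G : nat -> 'I_K -> 'M[R]_(m, d))
    (x : nat -> {RV P >-> borel_cV R d}) (u : nat -> T -> 'cV[R]_m)
    (mode : nat -> T -> 'I_K)
    (hcl : closed_loop N A B alpha mu Sigma v G x u mode)
    (a : 'I_L -> 'cV[R]_d) (ha : forall j, norm2 (a j) = 1)
    (b : 'I_L -> R) (V : R) (hV : 0 <= V <= 2^-1)
    (Sr : 'I_K -> 'I_L -> nat -> 'M[R]_d)
    (hSr : forall i j t, (1 <= t <= N)%N -> posdef (Sr i j t))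
    (r : 'I_K -> 'I_L -> nat -> R)
    (hr : forall i j t, (1 <= t <= N)%N -> 0 <= r i j t < 1) :
  convex_set (M := ((nat -> 'I_K -> 'cV[R]_d) * (nat -> 'I_K -> 'M[R]_d))%type)
    [set p | reformulation N alpha a b V Sr r p] /\
  ((forall i j t, (1 <= t <= N)%N -> 0 < alpha i -> r i j t <= 2^-1) ->
   reformulation N alpha a b V Sr r (mu, Sigma) ->
   ((1 - V)%:E <=
    P [set w | forall j t, (1 <= t <= N)%N -> halfspace (a j) (b j) (x t w)])%E).
Proof.
split; first exact: convex_reformulation.
move=> r_le [constr risk_le].
(* [viol j t] is the event that the state leaves half-space [j] at time [t]; the safety event is the
   complement of their union [U]. *)
pose viol (j : 'I_L) (t : nat) := x t @^-1` [set y | b j < dot (a j) y].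
pose U := \big[setU/set0]_(j < L) \big[setU/set0]_(1 <= t < N.+1) viol j t.
have mviol j t : measurable (viol j t).
  rewrite /viol -[X in measurable X]setTI.
  exact: (measurable_funPT (x t)) (measurable_dot_gt _ _).
have mviolU j : measurable (\big[setU/set0]_(1 <= t < N.+1) viol j t).
  exact: bigsetU_measurable.
have mU : measurable U by exact: bigsetU_measurable.
have -> : [set w | forall j t, (1 <= t <= N)%N ->
    halfspace (a j) (b j) (x t w)] = ~` U.
  apply/seteqP; split=> w /=.
    move=> safe; rewrite /U -bigcup_seq => -[j _]; rewrite -bigcup_seq => -[t /=].
    rewrite mem_index_iota ltnS => tN; apply/negP.
    by rewrite -leNgt; exact: safe.
  move=> notU j t tN; rewrite /halfspace/= leNgt; apply/negP => w_viol; apply: notU.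
  rewrite /U -bigcup_seq; exists j => /=; first by rewrite mem_index_enum.
  by rewrite -bigcup_seq; exists t => //=; rewrite mem_index_iota ltnS.
have viol_le j t : (1 <= t <= N)%N ->
    (P (viol j t) <= (\sum_(i < K) alpha i * r i j t)%:E)%E.
  move=> tN.
  have [t_gt0 t_le] := andP tN.
  apply: (GMM_tail_le (lambda := distribution P (x t)) (cl_GMM hcl t_le)).
    exact: cl_alpha_ge0 hcl.
  (* Writing [r] as [1 - (1 - r)] matches the tail bound taken at level [p = 1 - r]. *)
  move=> i alpha_gt0; rewrite -[r i j t](subKr 1).
  have [r_ge0 r_lt1] := andP (hr i j t tN).
  have r_le2 := r_le i j t tN alpha_gt0.
  have [_ Sr_gt0] := hSr i j t tN.
  apply: (normal_law_tail_le (s := Num.sqrt (quad (Sr i j t) (a j)))).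
  (* Positive definiteness is given only before time [N], so the variance at [t >= 1] is rewritten,
     by the covariance recursion, as a quadratic form in the covariance at the preceding time. *)
  - case: t t_gt0 t_le {tN r_ge0 r_lt1 r_le2 Sr_gt0} => // t _ t_lt.
    by rewrite (cl_cov hcl)// quad_congr posdef_quad_ge0//; exact: cl_posdef hcl _ _ _.
  - by rewrite sqrtr_gt0 Sr_gt0// norm2_eq1_neq0.
  - by apply/andP; split; lra.
  - exact: constr.
(* It remains to bound the probability of [U] by [V]. *)
rewrite probability_setC// EFinB leeB//.
apply: (le_trans (measure_bigsetU_le _ _ _)) => //.
apply: (@le_trans _ _ (\sum_(j < L) \sum_(1 <= t < N.+1)
    (\sum_(i < K) alpha i * r i j t)%:E)%E).
  apply: lee_sum => j _; apply: (le_trans (measure_bigsetU_le _ _ _)) => //.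
  rewrite big_nat [leRHS]big_nat; apply: lee_sum => t; rewrite ltnS; exact: viol_le.
under eq_bigr do rewrite sumEFin.
rewrite sumEFin lee_fin; apply: le_trans risk_le.
(* The union bound sums over [j], [t], then [i], the risk budget over [i], [j], [t]: the sum over
   [i] is moved inward twice. *)
rewrite [leRHS]exchange_big/=; apply: ler_sum => j _.
by rewrite exchange_big.
Qed.
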